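(* Let $\Gamma=(V,E,w)$ be a directed network with walk matrix $W$, and let $a_1,\dots,a_k\in V$ and $b_1,\dots,b_k\in V$ be such that for all $i<i'$ and $j'<j$, every walk from $a_i$ to $b_j$ has a vertex in common with every walk from $a_{i'}$ to $b_{j'}$. Let $W_{A,B}=(W(a_i,b_j))_{i,j=1}^k$. Then, as formal power series, $$\det(W_{A,B})=\sum w(\pi_1)\cdots w(\pi_k),$$ where the sum runs over all families of walks $\pi_i$ from $a_i$ to $b_i$ ($i=1,\dots,k$) such that for every $1\le i<k$ the walk $\pi_{i+1}$ has no vertex in common with $\mathrm{LE}(\pi_i)$. In particular, if the edge weights are specialized to nonnegative reals (with all the series involved convergent), then the matrix $W_{A,B}$ is totally nonnegative.
   Context: A directed network $\Gamma=(V,E,w)$ is a directed graph with vertex set $V$ and edge set $E$ (loops and multiple edges allowed) together with a family of commuting formal variables $\{w(e)\}_{e\in E}$. A walk $\pi$ of length $m$ from $a$ to $b$ is a sequence $a=a_0\xrightarrow{e_1}a_1\xrightarrow{e_2}\cdots\xrightarrow{e_m}a_m=b$ with each $e_i$ an edge from $a_{i-1}$ to $a_i$; its weight is $w(\pi)=\prod_i w(e_i)$, the length-$0$ walk having weight $1$. It is assumed that between any two vertices there are at most countably many walks of each fixed length, so that $W(a,b)=\sum_{\pi:a\to b}w(\pi)$ (sum over all walks from $a$ to $b$) is a well-defined formal power series; $W=(W(a,b))_{a,b\in V}$ is the walk matrix. Loop erasure: if all vertices $a_0,\dots,a_m$ of $\pi$ are distinct, $\mathrm{LE}(\pi)=\pi$;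 otherwise take $a_i=a_j$ ($i<j$) with $j$ as small as possible, delete the segment $a_i\xrightarrow{e_{i+1}}\cdots\xrightarrow{e_j}a_j$ from $\pi$ to obtain $\pi'$, and set $\mathrm{LE}(\pi)=\mathrm{LE}(\pi')$. A matrix is totally nonnegative if all its minors are nonnegative. *)

(* Defs.v *)
From HB Require Import structures.
From mathcomp Require Import all_boot all_order all_algebra.
From mathcomp Require Import fingroup perm.
From mathcomp Require Import finmap multiset.
From mathcomp Require Import all_classical all_reals all_analysis.

Set Implicit Arguments.
Unset Strict Implicit.
Unset Printing Implicit Defensive.

Import Order.TTheory GRing.Theory Num.Theory.

(* Directed networks.  A network is given by a vertex type V (with decidable
   equality), an edge type E (loops and multiple edges allowed, possibly
   infinite) and source/target maps.  The edge weights w(e) are commuting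
   formal variables, one per edge.                                          *)

Section Network.
Variables (V : eqType) (E : choiceType) (src tgt : E -> V).

(* A walk from x is encoded by its start vertex x and its list of edges
   [e_1; ...; e_m]; it is a walk from x to y when src e_1 = x,
   tgt e_i = src e_{i+1} and tgt e_m = y (for m = 0: x = y).               *)
Fixpoint is_walk (x y : V) (es : seq E) : bool :=
  match es with
  | [::] => x == y
  | e :: es' => (src e == x) && is_walk (tgt e) y es'
  end.

Definition walk_verts (x : V) (es : seq E) : seq V := x :: map tgt es.

(* Loop erasure (as in the paper): find the smallest j such that a_j = a_i
   for some i < j, delete the segment a_i -> ... -> a_j (i.e. the edges
   e_{i+1}, ..., e_j) and iterate.  The fuel n = size es suffices since
   each step strictly shortens the walk.                                    *)
Fixpoint le_edges (n : nat) (x : V) (es : seq E) : seq E :=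
  match n with
  | 0 => es
  | n'.+1 =>
      let vs := walk_verts x es in
      let j := find (fun j => nth x vs j \in take j vs) (iota 0 (size vs)) in
      if j < size vs then
        let i := index (nth x vs j) vs in
        le_edges n' x (take i es ++ drop j es)
      else es
  end.

(* LE(x, es), as a list of edges (it again starts at x). *)
Definition loop_erase (x : V) (es : seq E) : seq E := le_edges (size es) x es.

Definition meet (x : V) (p : seq E) (y : V) (q : seq E) : bool :=
  has (fun v => v \in walk_verts x p) (walk_verts y q).

End Network.

(* Formal power series in the commuting variables {w(e)}_{e in E} with
   integer coefficients: a monomial is a finite multiset of edges, a series
   is its coefficient function.  The weight of a walk is the monomial given
   by the multiset of its edges.                                            *)

Section FPS.
Variable E : choiceType.
Local Open Scope mset_scope.

Definition monomial := {mset E}.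
Definition fps := monomial -> int.

Definition walk_weight (es : seq E) : monomial := seq_mset es.

Definition fps_zero : fps := fun _ => 0%R.
Definition fps_one : fps := fun m => Posz (m == mset0 :> monomial).
Definition fps_add (f g : fps) : fps := fun m => (f m + g m)%R.

Fixpoint masks (n : nat) : seq (seq bool) :=
  if n is n'.+1 then [seq b :: bs | b <- [:: true; false], bs <- masks n']
  else [:: [::]].

Definition submonomials (m : monomial) : seq monomial :=
  undup [seq seq_mset (mask bs (enum_mset m)) | bs <- masks (size (enum_mset m))].

Definition fps_mul (f g : fps) : fps :=
  fun m => (\sum_(m1 <- submonomials m) f m1 * g (m `\` m1))%R.

Definition fps_det (k : nat) (A : 'I_k -> 'I_k -> fps) : fps :=
  fun m => (\sum_(s : 'S_k)
              (-1) ^+ s * foldr fps_mul fps_one [seq A i (s i) | i <- enum 'I_k] m)%R.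

(* The generating series sum_{pi : P pi} w(pi) of a predicate on walks
   (encoded by their edge lists): the coefficient of m is the number of
   edge lists pi with P pi whose multiset of edges is m; such pi are
   exactly the permutations of (enum_mset m), listed once each by
   [permutations].                                                          *)
Definition gf_walks (P : pred (seq E)) : fps :=
  fun m => Posz (count P (permutations (enum_mset m))).

Fixpoint splits (k : nat) (p : seq E) : seq (seq (seq E)) :=
  match k with
  | 0 => if p is [::] then [:: [::]] else [::]
  | k'.+1 => [seq take i p :: F | i <- iota 0 (size p).+1, F <- splits k' (drop i p)]
  end.

(* all k-families of edge lists whose union of edges is the multiset m,
   each listed exactly once *)
Definition families (k : nat) (m : monomial) : seq (seq (seq E)) :=
  flatten [seq splits k p | p <- permutations (enum_mset m)].

Definition gf_families (k : nat) (P : pred (seq (seq E))) : fps :=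
  fun m => Posz (count P (families k m)).

End FPS.

Section Theorem64.
Variables (V : eqType) (E : choiceType) (src tgt : E -> V).

Definition walk_series (x y : V) : fps E := gf_walks (is_walk src tgt x y).

Definition WAB (k : nat) (a b : 'I_k -> V) : 'I_k -> 'I_k -> fps E :=
  fun i j => walk_series (a i) (b j).

(* the families (pi_1, ..., pi_k), pi_i a walk from a_i to b_i, such that
   for all 1 <= i < k, pi_{i+1} has no vertex in common with LE(pi_i).
   (pi_i is the i-th component, indices shifted to start at 0.)            *)
Definition LE_family (k : nat) (a b : 'I_k -> V) (F : seq (seq E)) : bool :=
  [&& size F == k,
      [forall i : 'I_k, is_walk src tgt (a i) (b i) (nth [::] F i)] &
      [forall i : 'I_k, forall j : 'I_k, (j == i.+1 :> nat) ==>
         ~~ meet tgt (a i) (loop_erase tgt (a i) (nth [::] F i))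
                     (a j) (nth [::] F j)]].

Definition walk_wt_real (R : realType) (wr : E -> R) (es : seq E) : R :=
  (\prod_(e <- es) wr e)%R.

Definition walk_esum (R : realType) (wr : E -> R) (x y : V) : \bar R :=
  esum [set es | is_walk src tgt x y es] (fun es => ((walk_wt_real wr es)%:E)%R).

Definition walk_value (R : realType) (wr : E -> R) (x y : V) : R :=
  fine (walk_esum wr x y).

End Theorem64.

Definition totally_nonneg (R : realType) (k l : nat) (M : 'M[R]_(k, l)) : Prop :=
  forall (r : nat) (I : 'I_r -> 'I_k) (J : 'I_r -> 'I_l),
    (forall p q : 'I_r, p < q -> I p < I q)%N ->
    (forall p q : 'I_r, p < q -> J p < J q)%N ->
    (0 <= \det (\matrix_(p, q) M (I p) (J q)))%R.

(* Main.v *)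
(* Loop erasure keeps, at each vertex of the erased walk, the edge taken after
   the last visit to it; hence it can be computed by structural recursion.

   Expand the determinant over pairs (s, F) of a permutation s and a family F of
   walks from a_i to b_(s i).  Call F good if LE(F_i) is disjoint from F_j for all
   i < j.  On the pairs with F not good there is a sign-reversing, weight-preserving
   involution: take i minimal such that LE(F_i) meets a later walk, then the first
   vertex v along LE(F_i) lying on a later walk, then the first later walk F_j
   through v, and exchange the parts of F_i and F_j that follow their last visits
   to v.  The part of LE(F_i) before v and the union of the vertex sets of F_i and
   F_j are unchanged, so the same triple (i, j, v) is found again.

   The crossing hypothesis forces s = 1 on good families, and makes it
   sufficient to test goodness on consecutive walks: were LE(F_i) to meet F_j at v
   with j > i + 1, the walk following LE(F_i) to v and then F_j would cross
   LE(F_(i+1)), giving an intersection at smaller distance.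

   For nonnegative real weights the same involution embeds the odd pairs into
   the even ones, so the determinant is nonnegative even though the families
   may be infinite in number; a minor is an instance of the same statement. *)

Require Import Defs.
From HB Require Import structures.
From mathcomp Require Import all_boot all_order all_algebra.
From mathcomp Require Import fingroup perm.
From mathcomp Require Import finmap multiset.
From mathcomp Require Import all_classical all_reals all_analysis.

Set Implicit Arguments.
Unset Strict Implicit.
Unset Printing Implicit Defensive.

Import Order.TTheory GRing.Theory Num.Theory.

(** * Loop erasure by last exits *)

Section LoopErasure.
Variables (V : eqType) (E : choiceType) (src tgt : E -> V).
Implicit Types (x y v : V) (p q h t : seq E).

(* The recursion drops edges while keeping [x], so [p] need not start at [x]: the
   part of [p] before its last visit to [x] is then discarded. *)
Fixpoint last_exit x p : seq E :=
  if p is e :: p' then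
    if x \in map tgt p then last_exit x p' else e :: last_exit (tgt e) p'
  else [::].

Lemma last_exit_drop x p q :
  x \in map tgt q -> last_exit x (p ++ q) = last_exit x q.
Proof.
move=> xq; elim: p => //= e p IH.
by rewrite map_cat in_cons mem_cat xq !orbT.
Qed.

Lemma last_exit_closed x p q :
  last x (map tgt p) = x -> last_exit x (p ++ q) = last_exit x q.
Proof.
elim: p => //= e p IH lpx.
have -> : x \in tgt e :: map tgt (p ++ q).
  by rewrite map_cat -cat_cons mem_cat -{1}lpx mem_last.
by apply: IH; case: p lpx.
Qed.

(** This is one step of loop erasure. Along the simple walk [p] the membership tests do not see [c],
    which avoids every vertex of [p] but the last; at that last vertex [c] is a closed walk and is
    skipped. *)
Lemma last_exit_excise x p c q :
    uniq (x :: map tgt p) ->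
    {in x :: map tgt p, forall v, v != last x (map tgt p) -> v \notin map tgt c} ->
    last (last x (map tgt p)) (map tgt c) = last x (map tgt p) ->
  last_exit x (p ++ c ++ q) = last_exit x (p ++ q).
Proof.
elim: p x => [|e p IH] x; first by move=> _ _ lc; exact: (@last_exit_closed x c).
move=> up avoid lc.
have xq : (x \in map tgt ((e :: p) ++ c ++ q)) = (x \in map tgt ((e :: p) ++ q)).
  have /negbTE xc : x \notin map tgt c.
    apply: avoid; first exact: mem_head.
    case/andP: up => xp _; apply: contraNneq xp => xl; rewrite [X in X \in _]xl.
    exact: (mem_last (tgt e) (map tgt p)).
  by rewrite !map_cat !mem_cat xc.
rewrite cat_cons [LHS]/= [RHS]/= -2!map_cons -2!cat_cons xq.
case: ifP => [xin|_].
  have xq' : x \in map tgt q.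
    by case/andP: up => /negbTE xp _; move: xin; rewrite map_cat mem_cat xp.
  by rewrite catA !last_exit_drop.
congr (_ :: _); apply: IH => //.
- by case/andP: up.
- by move=> v vp; apply: avoid; rewrite /= in_cons vp orbT.
Qed.

Lemma last_exit_id x p : uniq (x :: map tgt p) -> last_exit x p = p.
Proof.
by elim: p x => //= e p IH x /andP[/negbTE xp up]; rewrite xp IH.
Qed.

(** Before the first repetition [a_j = a_i] all vertices are distinct, so the deleted segment is a
    cycle of the kind removed in [last_exit_excise]. Each deletion shortens the list, which allows
    induction on the fuel. *)
Lemma le_edgesE n x p : size p <= n -> le_edges tgt n x p = last_exit x p.
Proof.
elim: n p => [|n IH] p; first by case: p.
move=> sp; set vs := walk_verts tgt x p.
set f := (fun j => nth x vs j \in take j vs).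
have svs : size vs = (size p).+1 by rewrite /= size_map.
set j := find f (iota 0 (size vs)).
rewrite -[LHS]/(if j < size vs then le_edges tgt n x
  (take (index (nth x vs j) vs) p ++ drop j p) else p).
have nf j' : j' < j -> f j' = false.
  move=> lj; have := before_find 0 lj.
  rewrite nth_iota ?add0n //; apply: (leq_trans lj).
  by rewrite -[X in _ <= X](size_iota 0); exact: find_size.
have utake m : m <= j -> m <= size vs -> uniq (take m vs).
  elim: m => [|m IHm] lmj lms; first by rewrite take0.
  by rewrite (take_nth x) // rcons_uniq IHm ?(ltnW lmj) ?(ltnW lms) // andbT [_ \in _]nf.
case: ifPn => [ltj|]; last first.
  rewrite -leqNgt => lej; rewrite last_exit_id // -/(walk_verts tgt x p) -/vs.
  by rewrite -(take_size vs) utake.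
have fj : f j.
  have hf : has f (iota 0 (size vs)) by rewrite has_find size_iota.
  by have := nth_find 0 hf; rewrite -/j nth_iota.
set i := index _ _.
have u := utake j (leqnn _) (ltnW ltj).
have lij : i < j.
  move: fj; rewrite /f -{1}(cat_take_drop j vs) -index_mem => fj.
  by rewrite /i -(cat_take_drop j vs) index_cat -index_mem fj (leq_trans fj) // size_take ltj.
have eij : nth x vs i = nth x vs j by apply: nth_index; apply: mem_nth.
have ljp : j <= size p by rewrite -ltnS -svs.
have lip : i <= size p by apply: leq_trans (ltnW lij) ljp.
have ep : p = take i p ++ drop i (take j p) ++ drop j p.
  rewrite -{1}(cat_take_drop j p) catA; congr (_ ++ _).
  by rewrite -{1}(cat_take_drop i (take j p)) take_takel // ltnW.
have lastE m : m <= size p -> last x (map tgt (take m p)) = nth x vs m.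
  move=> lm; rewrite (last_nth x) size_map size_takel // map_take.
  by rewrite /vs /walk_verts; case: m lm => //= m lm; rewrite nth_take.
rewrite IH; last first.
  rewrite size_cat size_takel // size_drop -ltnS.
  apply: leq_trans sp.
  by rewrite -{2}(subnKC ljp) ltn_add2r.
rewrite [in RHS]ep last_exit_excise //.
- rewrite map_take -[x :: _]/(take i.+1 vs).
  by apply: utake => //; rewrite svs ltnS.
- move=> v vi; rewrite lastE // => nvi; rewrite map_drop map_take.
  (* The segment visits [a_(i+1), ..., a_(j-1)] and then [a_j = a_i]; for [j = i + 1] it is a loop
     edge and the first part is empty. *)
  have -> : drop i (take j (map tgt p)) = rcons (drop i.+1 (take j vs)) (nth x vs j).
    have -> : drop i (take j (map tgt p)) = drop i.+1 (take j.+1 vs) by [].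
    rewrite (take_nth x) // -!cats1 drop_cat size_takel ?(ltnW ltj) //.
    case: ltnP => // ji; have -> : i.+1 = j by apply/eqP; rewrite eqn_leq lij ji.
    by rewrite subnn drop0 drop_oversize // size_takel ?(ltnW ltj).
  rewrite mem_rcons in_cons -eij negb_or nvi /=.
  move: u; rewrite -{1}(cat_take_drop i.+1 (take j vs)) cat_uniq.
  rewrite take_takel // => /and3P[_ /hasPn h _]; apply/negP => /h /negP; apply.
  by move: vi; rewrite map_take.
- rewrite -last_cat -map_cat -{1}(@take_takel _ i j) ?(ltnW lij) // cat_take_drop.
  by rewrite !lastE.
Qed.

Lemma loop_eraseE x p : loop_erase tgt x p = last_exit x p.
Proof. exact: le_edgesE. Qed.

Lemma sub_last_exit x p : {subset last_exit x p <= p}.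
Proof.
elim: p x => //= e p IH x f; case: ifP => _; rewrite !in_cons.
  by move=> /IH ->; rewrite orbT.
by case/predU1P => [->|/IH ->]; rewrite ?eqxx ?orbT.
Qed.

Lemma sub_map_last_exit x p : {subset map tgt (last_exit x p) <= map tgt p}.
Proof. by move=> v /mapP[e /sub_last_exit ep ->]; exact: map_f. Qed.

Lemma uniq_last_exit x p : uniq (x :: map tgt (last_exit x p)).
Proof.
elim: p x => // e p IH x; rewrite [last_exit _ _]/=; case: ifPn => [_|xp]; first exact: IH.
rewrite map_cons [uniq _]/= -/(uniq (tgt e :: map tgt (last_exit (tgt e) p))) IH andbT.
apply: contra xp; rewrite /= !in_cons => /predU1P[->|/sub_map_last_exit ->].
  by rewrite eqxx.
by rewrite orbT.
Qed.

Lemma last_last_exit x p : last x (map tgt (last_exit x p)) = last x (map tgt p).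
Proof.
elim: p x => // e p IH x; rewrite [last_exit _ _]/=; case: ifPn => [xp|_]; last exact: IH.
rewrite IH /=; case: p xp {IH} => //=.
by rewrite inE => /eqP.
Qed.

Lemma is_walk_cat x z p q :
  is_walk src tgt x z (p ++ q) =
  is_walk src tgt x (last x (map tgt p)) p && is_walk src tgt (last x (map tgt p)) z q.
Proof.
elim: p x => [|e p IH] x /=; first by rewrite eqxx.
by rewrite IH andbA.
Qed.

Lemma is_walk_last_exit x z p :
  is_walk src tgt x z p -> is_walk src tgt x z (last_exit x p).
Proof.
(* While edges are being dropped, the remaining list starts at some [y], possibly other than [x],
   and still has to visit [x]. *)
suff suffix y : x \in y :: map tgt p -> is_walk src tgt y z p ->
    is_walk src tgt x z (last_exit x p).
  by apply: suffix; exact: mem_head.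
elim: p x y => [|e p IH] x y /=; first by rewrite inE => /eqP ->.
rewrite in_cons => xin /andP[/eqP sy ep]; case: ifPn xin => [xp _|_ /orP[/eqP ->|//]].
  exact: IH ep.
by rewrite /= sy eqxx; apply: IH ep; exact: mem_head.
Qed.

(* For [last x (map tgt h) = v] and [v \notin map tgt t], [h ++ t] splits a
   walk at its last visit to [v]. *)
Lemma last_exit_cat x v h t :
    last x (map tgt h) = v ->
    {in x :: map tgt (last_exit x h), forall u, u \notin map tgt t} ->
  last_exit x (h ++ t) = last_exit x h ++ last_exit v t.
Proof.
elim: h x => [|e h IH] x; first by move=> /= ->.
move=> lv avoid.
have /negbTE xt : x \notin map tgt t by apply: avoid; exact: mem_head.
have xh : (x \in map tgt ((e :: h) ++ t)) = (x \in map tgt (e :: h)).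
  by rewrite map_cat mem_cat xt orbF.
move: avoid; rewrite cat_cons [last_exit _ (_ :: _)]/= [in RHS]/= [in LHS]/=.
rewrite -2!map_cons -cat_cons xh; case: ifPn => [xin|_] avoid.
  apply: IH => //; case: h {xh avoid} lv xin => //= ->.
  by rewrite inE => /eqP.
rewrite cat_cons IH // => u uh; apply: avoid.
by rewrite in_cons map_cons uh orbT.
Qed.

(** If a vertex kept from [h] recurred in [t], the erasure would jump past [v] into [t], which
    avoids [v], and [v] could not survive. This supplies the avoidance hypothesis of
    [last_exit_cat]. *)
Lemma last_exit_split x v h t :
    last x (map tgt h) = v -> v \notin map tgt t ->
    v \in x :: map tgt (last_exit x (h ++ t)) ->
  {in x :: map tgt (last_exit x h), forall u, u \notin map tgt t}.
Proof.
elim: h x => [|e h IH] x.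
  by move=> /= -> vt _ u; rewrite inE => /eqP ->.
move=> lv vt.
case: (boolP (x \in map tgt t)) => [xt|xt].
  rewrite last_exit_drop // in_cons => /predU1P[vx|/sub_map_last_exit].
    by rewrite vx xt in vt.
  by rewrite (negbTE vt).
have xh : (x \in map tgt ((e :: h) ++ t)) = (x \in map tgt (e :: h)).
  by rewrite map_cat mem_cat (negbTE xt) orbF.
rewrite cat_cons ![last_exit _ (_ :: _)]/= -2!map_cons -cat_cons xh.
case: ifPn => [xin|xin] vin.
  apply: IH => //; case: h {xh vin} lv xin => //= ->.
  by rewrite inE => /eqP.
have {}vin : v \in tgt e :: map tgt (last_exit (tgt e) (h ++ t)).
  move: vin; rewrite in_cons => /predU1P[vx|//].
  by rewrite -vx -lv /= mem_last in xin.
move=> u; rewrite in_cons => /predU1P[->//|]; exact: IH.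
Qed.
End LoopErasure.

(** * Crossings of a family and the exchange of tails *)

Section TailSwap.
Variables (V : eqType) (E : choiceType) (src tgt : E -> V).
Implicit Types (x y v : V) (p q h t : seq E).

(** The start vertex is not an argument: when no edge ends at [v] the whole list is returned, which
    is correct for a walk that starts at [v] and never comes back. *)
Fixpoint tail_after v p : seq E :=
  if p is e :: p' then if v \in map tgt p then tail_after v p' else p else [::].

Definition head_upto v p := take (size p - size (tail_after v p)) p.

Lemma tail_after_id v p : v \notin map tgt p -> tail_after v p = p.
Proof. by case: p => //= e p /negbTE ->. Qed.

Lemma tail_after_cat x v h t :
  last x (map tgt h) = v -> v \notin map tgt t -> tail_after v (h ++ t) = t.
Proof.
elim: h x => [|e h IH] x lv vt; first exact: tail_after_id.
have vin : v \in map tgt ((e :: h) ++ t).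
  by rewrite map_cat mem_cat -lv [X in X || _](mem_last (tgt e) (map tgt h)).
by rewrite cat_cons /= -map_cons vin; exact: IH lv vt.
Qed.

Lemma head_upto_cat x v h t :
  last x (map tgt h) = v -> v \notin map tgt t -> head_upto v (h ++ t) = h.
Proof.
move=> lv vt; rewrite /head_upto (tail_after_cat lv vt) size_cat addnK.
exact: take_size_cat.
Qed.

Lemma last_visit_split x v p : v \in x :: map tgt p ->
  [/\ p = head_upto v p ++ tail_after v p,
      last x (map tgt (head_upto v p)) = v & v \notin map tgt (tail_after v p)].
Proof.
move=> vp.
suff [h [t [ep lv vt]]] : exists h t,
    [/\ p = h ++ t, last x (map tgt h) = v & v \notin map tgt t].
  by rewrite ep (head_upto_cat lv vt) (tail_after_cat lv vt).
elim: p x vp => [|e p IH] x; first by rewrite mem_seq1 => /eqP ->; exists [::], [::].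
case: (boolP (v \in map tgt (e :: p))) => [vp _|vp].
  by have [h [t [-> lv vt]]] := IH _ vp; exists (e :: h), t.
by rewrite in_cons (negbTE vp) orbF => /eqP vx; exists [::], (e :: p).
Qed.

Variables (k : nat) (a b : 'I_k -> V).
Implicit Types (F : seq (seq E)) (i j : 'I_k).

Definition verts F i := walk_verts tgt (a i) (nth [::] F i).
Definition erased_verts F i :=
  walk_verts tgt (a i) (last_exit tgt (a i) (nth [::] F i)).
Definition hit F i v := [exists j : 'I_k, (i < j) && (v \in verts F j)].
(** These are the good families: the condition concerns all pairs [i < j], not only consecutive
    ones. *)
Definition fully_erased F := [forall i, all (fun u => ~~ hit F i u) (erased_verts F i)].

Lemma sub_erased_verts F i : {subset erased_verts F i <= verts F i}.
Proof.
move=> u; rewrite /erased_verts /verts /walk_verts !in_cons.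
by case/predU1P => [->|/sub_map_last_exit ->]; rewrite ?eqxx ?orbT.
Qed.

Lemma hitP F i v : reflect (exists2 j : 'I_k, i < j & v \in verts F j) (hit F i v).
Proof.
apply: (iffP existsP) => [[j /andP[]]|[j ij vj]]; first by exists j.
by exists j; rewrite ij.
Qed.

(* The crossing at which tails are swapped: [i] is minimal such that the
   erasure of the [i]-th walk meets a later walk, [v] is the first vertex along
   this erasure lying on a later walk, and the [j]-th is the first such walk. *)
Definition crossing F (c : 'I_k * 'I_k * V) : Prop :=
  let: (i, j, v) := c in
  [/\ forall i', i' < i -> {in erased_verts F i', forall u, ~~ hit F i' u},
      exists s t : seq V, erased_verts F i = s ++ v :: t /\ {in s, forall u, ~~ hit F i u},
      i < j, v \in verts F j &
      forall j', i < j' < j -> v \notin verts F j'].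

Lemma crossing_exists F : ~~ fully_erased F -> exists c, crossing F c.
Proof.
rewrite negb_forall => /existsP[i0 bad0].
case: (@arg_minnP _ i0 (fun i => ~~ all (fun u => ~~ hit F i u) (erased_verts F i))
         (@nat_of_ord k) bad0) => i bad mini.
have hh : has (hit F i) (erased_verts F i).
  by move: bad; rewrite -has_predC; apply: sub_has => u /=; rewrite negbK.
pose l := find (hit F i) (erased_verts F i).
pose v := nth (a i) (erased_verts F i) l.
have hv : hit F i v by exact: nth_find.
have [j0 ij0 vj0] := hitP _ _ _ hv.
have bj0 : (i < j0) && (v \in verts F j0) by rewrite ij0.
case: (@arg_minnP _ j0 (fun j => (i < j) && (v \in verts F j)) (@nat_of_ord k) bj0)
  => j /andP[ij vj] minj.
exists (i, j, v); split=> //.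
- move=> i' li'; have := contra (mini i'); rewrite -ltnNge li' negbK => /(_ isT) /allP.
  by [].
- exists (take l (erased_verts F i)), (drop l.+1 (erased_verts F i)); split.
    by rewrite -drop_nth ?cat_take_drop // -has_find.
  move=> u ul; apply/negP => hu.
    have : ~~ has (hit F i) (take l (erased_verts F i)) by rewrite has_take // ltnn.
    by move=> /hasPn /(_ u ul); rewrite hu.
- move=> j' /andP[ij' lj']; apply/negP => vj'.
  by have := minj j'; rewrite ij' vj' leqNgt lj' => /(_ isT).
Qed.

Lemma first_hit_uniq (P : pred V) (s t : seq V) v (s' t' : seq V) v' :
    s ++ v :: t = s' ++ v' :: t' ->
    {in s, forall u, ~~ P u} -> P v -> {in s', forall u, ~~ P u} -> P v' ->
  s = s' /\ v = v'.
Proof.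
have findE (s1 t1 : seq V) v1 : {in s1, forall u, ~~ P u} -> P v1 ->
    find P (s1 ++ v1 :: t1) = size s1.
  move=> avoid Pv; rewrite find_cat ifN /= ?Pv ?addn0 //.
  by apply/hasPn.
move=> e avoid Pv avoid' Pv'.
have es : size s = size s' by rewrite -(findE s t v) // e findE.
by move/eqP: e; rewrite eqseq_cat // => /andP[/eqP -> /eqP[-> _]].
Qed.

(** Each of [i], [v], [j], in this order, is pinned down by its minimality once the previous ones
    are known. Hence the swap depends on the family alone. *)
Lemma crossing_uniq F c c' : crossing F c -> crossing F c' -> c = c'.
Proof.
move: c c' => [[i j] v] [[i' j'] v'].
move=> [mini [s [t [es avoid]]] ij vj minj] [mini' [s' [t' [es' avoid']]] ij' vj' minj'].
have hv : hit F i v by apply/hitP; exists j.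
have hv' : hit F i' v' by apply/hitP; exists j'.
have vin : v \in erased_verts F i by rewrite es mem_cat mem_head orbT.
have vin' : v' \in erased_verts F i' by rewrite es' mem_cat mem_head orbT.
have ii' : i = i'.
  apply: val_inj; case: (ltngtP i i') => // li.
    by have := mini' _ li _ vin; rewrite hv.
  by have := mini _ li _ vin'; rewrite hv'.
subst i'; rewrite es in es'.
have [_ vv'] := first_hit_uniq es' avoid hv avoid' hv'; subst v'.
suff -> : j = j' by [].
apply: val_inj; case: (ltngtP j j') => // lj.
  by have := minj' j; rewrite ij lj vj => /(_ isT).
by have := minj j'; rewrite ij' lj vj' => /(_ isT).
Qed.

Definition swap_tails F i j v : seq (seq E) :=
  let p := nth [::] F i in let q := nth [::] F j in
  set_nth [::] (set_nth [::] F i (head_upto v p ++ tail_after v q))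
    j (head_upto v q ++ tail_after v p).

Lemma size_swap_tails F i j v : size F = k -> size (swap_tails F i j v) = k.
Proof.
move=> sF; rewrite !size_set_nth sF.
by rewrite (maxn_idPr (ltn_ord i)) (maxn_idPr (ltn_ord j)).
Qed.

Lemma nth_swap_tails F i j v l : i != j ->
  nth [::] (swap_tails F i j v) l =
  if l == j :> nat then head_upto v (nth [::] F j) ++ tail_after v (nth [::] F i)
  else if l == i :> nat then head_upto v (nth [::] F i) ++ tail_after v (nth [::] F j)
  else nth [::] F l.
Proof. by move=> ij; rewrite !nth_set_nth /= nth_set_nth. Qed.

Lemma mem_verts_cat x h t u :
  (u \in walk_verts tgt x (h ++ t)) = (u \in walk_verts tgt x h) || (u \in map tgt t).
Proof. by rewrite /walk_verts map_cat -cat_cons mem_cat. Qed.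

Section Swap.
Variables (F : seq (seq E)) (i j : 'I_k) (v : V).
Hypothesis cross : crossing F (i, j, v).

Let p := nth [::] F i.
Let q := nth [::] F j.
Let F' := swap_tails F i j v.

Lemma crossing_neq : i != j.
Proof. by case: cross => _ _ ij _ _; rewrite -val_eqE /= ltn_eqF. Qed.

Lemma crossing_splitl : [/\ p = head_upto v p ++ tail_after v p,
  last (a i) (map tgt (head_upto v p)) = v & v \notin map tgt (tail_after v p)].
Proof.
apply: last_visit_split; case: cross => _ [s [t [es _]]] _ _ _.
by apply: (sub_erased_verts (F := F)); rewrite es mem_cat mem_head orbT.
Qed.

Lemma crossing_splitr : [/\ q = head_upto v q ++ tail_after v q,
  last (a j) (map tgt (head_upto v q)) = v & v \notin map tgt (tail_after v q)].
Proof. by apply: last_visit_split; case: cross. Qed.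

Lemma swap_nthi : nth [::] F' i = head_upto v p ++ tail_after v q.
Proof.
by rewrite nth_swap_tails ?crossing_neq // eqxx ifN //; exact: crossing_neq.
Qed.

Lemma swap_nthj : nth [::] F' j = head_upto v q ++ tail_after v p.
Proof. by rewrite nth_swap_tails ?crossing_neq // eqxx. Qed.

Lemma swap_nth (l : 'I_k) : l != i -> l != j -> nth [::] F' l = nth [::] F l.
Proof.
by move=> li lj; rewrite nth_swap_tails ?crossing_neq // !ifN.
Qed.

(** Both heads end at [v] and both tails avoid [v], so the new walks leave [v] for the last time
    exactly at the gluing points, and a second swap returns the tails. *)
Lemma swap_tailsK : size F = k -> swap_tails F' i j v = F.
Proof.
have [ep lp vp] := crossing_splitl; have [eq lq vq] := crossing_splitr.
move=> sF; apply: (@eq_from_nth _ [::]); first by rewrite !size_swap_tails.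
rewrite !size_swap_tails // => l lk; rewrite nth_swap_tails ?crossing_neq //.
rewrite swap_nthi swap_nthj (head_upto_cat lp vq) (tail_after_cat lp vq).
rewrite (head_upto_cat lq vp) (tail_after_cat lq vp) -ep -eq.
case: eqP => [->//|/eqP lj]; case: eqP => [->//|/eqP li].
exact: (@swap_nth (Ordinal lk)).
Qed.

Lemma perm_flatten_swap : size F = k -> perm_eq (flatten F') (flatten F).
Proof.
move=> sF; apply/seq.permP => P.
have countE G : size G = k -> count P (flatten G) = \sum_(l < k) count P (nth [::] G l).
  by move=> <-; rewrite count_flatten sumnE big_map (big_nth [::]) big_mkord.
rewrite !countE ?size_swap_tails // (bigD1 i) // (bigD1 j) 1?eq_sym ?crossing_neq //=.
rewrite [RHS](bigD1 i) //= [in RHS](bigD1 j) 1?eq_sym ?crossing_neq //=.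
have [ep _ _] := crossing_splitl; have [eq _ _] := crossing_splitr.
rewrite swap_nthi swap_nthj -/p -/q [in RHS]ep [in RHS]eq !count_cat !addnA.
congr (_ + _)%N.
  by rewrite -!addnA; congr (_ + _)%N; rewrite [LHS]addnC [LHS]addnAC [LHS]addnC.
by apply: eq_bigr => l /andP[li lj]; rewrite swap_nth.
Qed.

(** Exchanging tails exchanges endpoints. The transposition stands on the left because the left
    factor of a product of permutations acts first. *)
Lemma swap_walks (s : {perm 'I_k}) :
  (forall l, is_walk src tgt (a l) (b (s l)) (nth [::] F l)) ->
  forall l, is_walk src tgt (a l) (b ((tperm i j * s)%g l)) (nth [::] F' l).
Proof.
move=> walks l; rewrite permM.
have [ep lp _] := crossing_splitl; have [eq lq _] := crossing_splitr.
have := walks j; have := walks i; rewrite -/p -/q {1}ep {1}eq.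
rewrite !is_walk_cat lp lq => /andP[wi wi'] /andP[wj wj'].
case: tpermP => [->|->|/eqP li /eqP lj].
- by rewrite swap_nthi is_walk_cat lp wi.
- by rewrite swap_nthj is_walk_cat lq wj.
- by rewrite swap_nth.
Qed.

(** The key to involutivity: the erased part up to [v], the union of the vertices of walks [i] and
    [j], and all other walks survive the swap, and these determine the crossing. *)
Lemma crossing_swap_tails : crossing F' (i, j, v).
Proof.
have [mini [s [t [es avoid]]] ij vj minj] := cross.
have [ep lp vp] := crossing_splitl; have [eq lq vq] := crossing_splitr.
have nji : j != i by rewrite eq_sym crossing_neq.
have vertsE (l : 'I_k) : l != i -> l != j -> verts F' l = verts F l.
  by move=> li lj; rewrite /verts swap_nth.
have erasedE (l : 'I_k) : l < i -> erased_verts F' l = erased_verts F l.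
  move=> li; rewrite /erased_verts swap_nth //; rewrite -val_eqE /=; last first.
    by rewrite ltn_eqF // (ltn_trans li).
  by rewrite ltn_eqF.
have verts_swap u : (u \in verts F' i) || (u \in verts F' j) ->
    (u \in verts F i) || (u \in verts F j).
  rewrite /verts swap_nthi swap_nthj -/p -/q [in X in _ -> X]ep [in X in _ -> X]eq.
  rewrite !mem_verts_cat.
  by do 4!case: (u \in _).
have avoid_p : {in a i :: map tgt (last_exit tgt (a i) (head_upto v p)),
    forall u, u \notin map tgt (tail_after v p)}.
  apply: (last_exit_split lp vp); rewrite -ep.
  by change (v \in erased_verts F i); rewrite es mem_cat mem_head orbT.
(* Erasing the head alone already yields the erased walk up to [v]: both sides cut the same
   duplicate-free vertex list at [v]. *)
have e_head : a i :: map tgt (last_exit tgt (a i) (head_upto v p)) = rcons s v.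
  have e : erased_verts F i =
      belast (a i) (map tgt (last_exit tgt (a i) (head_upto v p))) ++
      v :: map tgt (last_exit tgt v (tail_after v p)).
    rewrite /erased_verts /walk_verts -/p {1}ep (last_exit_cat lp avoid_p).
    by rewrite map_cat -cat_cons lastI last_last_exit lp cat_rcons.
  have u : uniq (erased_verts F i) := uniq_last_exit tgt (a i) p.
  rewrite lastI last_last_exit lp; congr rcons.
  have vs : v \notin s.
    by move: u; rewrite es cat_uniq => /and3P[_ /hasPn/(_ v (mem_head _ _))].
  have := u; rewrite e cat_uniq => /and3P[_ /hasPn/(_ v (mem_head _ _)) vb _].
  rewrite es in e.
  have as_ : {in s, forall w, ~~ pred1 v w}.
    by move=> w ws /=; apply: (contraNneq _ vs) => wv; rewrite -wv.
  have ab : {in belast (a i) (map tgt (last_exit tgt (a i) (head_upto v p))),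
      forall w, ~~ pred1 v w}.
    by move=> w ws /=; apply: (contraNneq _ vb) => wv; rewrite -[X in X \in _]wv.
  by have [->] := first_hit_uniq e as_ (eqxx v) ab (eqxx v).
(* Hence the tail arriving from walk [j] revisits nothing in [s], and the erasure of the new walk
   [i] again begins with [s] followed by [v]. *)
have sq u : u \in s -> u \notin verts F j.
  by move=> us; apply: contra (avoid _ us) => uj; apply/hitP; exists j.
split=> //.
(* Walks [i] and [j] are both later than [i'], so for [i'] only the union of their vertices
   matters. *)
- move=> i' li' u; rewrite erasedE // => ui; have := mini _ li' _ ui.
  apply: contra => /hitP[l li'l ul]; apply/hitP.
  have ij' : i' < j by exact: ltn_trans ij.
  have [[li|lj]|] : (l = i \/ l = j) \/ (l != i /\ l != j).
  + case: (eqVneq l i) => [->|]; first by left; left.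
    by case: (eqVneq l j) => [->|]; [left; right | right].
  + have /verts_swap/orP[] : (u \in verts F' i) || (u \in verts F' j) by rewrite -li ul.
      by exists i.
    by exists j.
  + have /verts_swap/orP[] : (u \in verts F' i) || (u \in verts F' j) by rewrite -lj ul orbT.
      by exists i.
    by exists j.
  by case=> li lj; exists l; rewrite // -vertsE.
- exists s, (map tgt (last_exit tgt v (tail_after v q))); split.
    rewrite /erased_verts /walk_verts swap_nthi (last_exit_cat lp).
      by rewrite map_cat -cat_cons e_head cat_rcons.
    move=> u; rewrite e_head mem_rcons in_cons => /predU1P[->//|/sq].
    by rewrite /verts -/q {1}eq mem_verts_cat negb_or => /andP[].
  (* The new walk [j] avoids [s]: its head by [sq], and its tail, taken from walk [i], by
     [avoid_p]. *)
  move=> u us; apply/negP => /hitP[l il ul].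
  have [lj|lj] := eqVneq l j.
    move: ul; rewrite lj /verts swap_nthj mem_verts_cat => /orP[uq|].
      by have := sq _ us; rewrite /verts -/q {1}eq mem_verts_cat uq.
    by apply/negP; apply: avoid_p; rewrite e_head mem_rcons in_cons us orbT.
  have li : l != i by rewrite -val_eqE /= gtn_eqF.
  by have /hitP[] := avoid _ us; exists l; rewrite // -vertsE.
- by rewrite /verts swap_nthj mem_verts_cat -{1}lq mem_last.
- move=> l /andP[il lj]; rewrite vertsE ?minj ?il //.
    by rewrite -val_eqE /= gtn_eqF.
  by rewrite -val_eqE /= ltn_eqF.
Qed.

End Swap.
End TailSwap.

(** * The involution on configurations and the use of the crossing hypothesis *)

Section Configurations.
Variables (V : eqType) (E : choiceType) (src tgt : E -> V).
Variables (k : nat) (a b : 'I_k -> V).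
Implicit Types (F : seq (seq E)) (i j : 'I_k) (s : {perm 'I_k}).

Definition walks s F :=
  [forall l, is_walk src tgt (a l) (b (s l)) (nth [::] F l)].

Definition tangled (x : {perm 'I_k} * seq (seq E)) :=
  [&& size x.2 == k, walks x.1 x.2 & ~~ fully_erased tgt a x.2].

(** The crossing is extracted by classical choice; [crossing_uniq] makes the outcome independent of
    the choice. Configurations without a crossing are fixed. *)
Definition swap_config (x : {perm 'I_k} * seq (seq E)) :=
  if pselect (exists c, crossing tgt a x.2 c) is left h then
    let: (i, j, v) := projT1 (cid h) in
    ((tperm i j * x.1)%g, swap_tails tgt x.2 i j v)
  else x.

Lemma swap_configE s F i j v : crossing tgt a F (i, j, v) ->
  swap_config (s, F) = ((tperm i j * s)%g, swap_tails tgt F i j v).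
Proof.
move=> c; rewrite /swap_config; case: pselect => [h|[]]; last by exists (i, j, v).
by case: cid => c' /= /(crossing_uniq c) <-.
Qed.

Lemma crossing_tangled F c : crossing tgt a F c -> ~~ fully_erased tgt a F.
Proof.
case: c => [[i j] v] [_ [s [t [es _]]] ij vj _].
rewrite negb_forall; apply/existsP; exists i; apply/allPn; exists v.
  by rewrite es mem_cat mem_head orbT.
by rewrite negbK; apply/hitP; exists j.
Qed.

Lemma swap_config_tangled x : tangled x ->
  [/\ tangled (swap_config x), swap_config (swap_config x) = x,
      odd_perm (swap_config x).1 = ~~ odd_perm x.1 &
      perm_eq (flatten (swap_config x).2) (flatten x.2)].
Proof.
case: x => s F /and3P[/= /eqP sF /forallP walksF /crossing_exists[[[i j] v] c]].
have c' := crossing_swap_tails c.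
rewrite (swap_configE _ c) (swap_configE _ c') mulgA tperm2 mul1g (swap_tailsK c sF).
split=> //.
- apply/and3P; split; first by rewrite size_swap_tails.
    by apply/forallP => l; apply: (swap_walks c).
  exact: crossing_tangled c'.
- by rewrite odd_permM odd_tperm (crossing_neq c).
- exact: perm_flatten_swap c sF.
Qed.

Hypothesis hcross : forall i i' j j' : 'I_k, i < i' -> j' < j ->
  forall p q : seq E,
    is_walk src tgt (a i) (b j) p -> is_walk src tgt (a i') (b j') q ->
    meet tgt (a i) p (a i') q.

Definition adjacent_avoid F :=
  [forall i : 'I_k, forall j : 'I_k, (j == i.+1 :> nat) ==>
     ~~ meet tgt (a i) (loop_erase tgt (a i) (nth [::] F i)) (a j) (nth [::] F j)].

Lemma adjacent_avoidP F : reflect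
  (forall i j, j = i.+1 :> nat ->
     {in erased_verts tgt a F i, forall u, u \notin verts tgt a F j})
  (adjacent_avoid F).
Proof.
apply: (iffP forallP) => [avoid i j ij u ui|avoid i].
  move: (avoid i) => /forallP/(_ j)/implyP/(_ (introT eqP ij))/hasPn nm.
  by apply: contraL ui => uj; have := nm u uj; rewrite loop_eraseE.
apply/forallP => j; apply/implyP => /eqP ij; apply/hasPn => u uj.
rewrite loop_eraseE; apply/negP => ui.
by have := avoid i j ij u ui; rewrite /verts uj.
Qed.

Lemma walks_last_exit s F i : walks s F ->
  is_walk src tgt (a i) (b (s i)) (last_exit tgt (a i) (nth [::] F i)).
Proof. by move=> /forallP/(_ i); exact: is_walk_last_exit. Qed.

(** Monotonicity gives [i <= s i] for all [i]; both sides have the same sum, so equality holds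
    throughout. *)
Lemma perm_nondecreasing s : (forall i j, j = i.+1 :> nat -> s i < s j) -> s = 1%g.
Proof.
move=> incr.
have le_s i : i <= s i.
  case: i => m; elim: m => [//|m IH] lm.
  apply: leq_ltn_trans (IH (ltnW lm)) _.
  exact: incr.
have := @leqif_sum _ predT (fun i => i == s i) (fun i : 'I_k => i : nat)
  (fun i => s i : nat) (fun i _ => leqif_eq (le_s i)).
rewrite [X in _ <= X ?= iff _](_ : _ = \sum_(i < k) i); last first.
  by rewrite [RHS](reindex_inj (@perm_inj _ s)).
case=> _; rewrite eqxx => /esym/forallP fix_s.
by apply/permP => i; rewrite perm1; have /implyP/(_ isT)/eqP <- := fix_s i.
Qed.

(** A descent of [s] at consecutive [i], [j] would put the endpoints of LE(F_i) and F_j in crossing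
    position, forcing these two walks to meet. *)
Lemma adjacent_avoid_id s F : walks s F -> adjacent_avoid F -> s = 1%g.
Proof.
move=> wF /adjacent_avoidP avoid; apply: perm_nondecreasing => i j ij.
have lij : i < j by rewrite ij.
rewrite ltnNge leq_eqVlt negb_or; apply/andP; split.
  by rewrite val_eqE (inj_eq perm_inj) -val_eqE /= gtn_eqF.
apply/negP => lji.
have /hasP[u uj ui] := hcross lij lji (walks_last_exit i wF) (forallP wF j).
by have := avoid i j ij u ui; rewrite /verts uj.
Qed.

Lemma adjacent_avoid_fully_erased F :
  walks 1%g F -> adjacent_avoid F -> fully_erased tgt a F.
Proof.
move=> wF /adjacent_avoidP avoid.
have walkF i : is_walk src tgt (a i) (b i) (nth [::] F i).
  by have /forallP/(_ i) := wF; rewrite perm1.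
suff gap n i j : j = i + n.+1 :> nat ->
    {in erased_verts tgt a F i, forall u, u \notin verts tgt a F j}.
  apply/forallP => i; apply/allP => u ui; apply/negP => /hitP[j ij].
  by apply/negP; apply: (gap (j - i.+1)) ui; rewrite addnS -addSn subnKC.
elim: n i j => [|n IH] i j ij v vi; first by apply: avoid vi; rewrite ij addn1.
apply/negP => vj.
have mk : i.+1 < k by apply: leq_ltn_trans (ltn_ord j); rewrite ij !addnS ltnS leqW ?leq_addr.
pose m := Ordinal mk.
have lmj : m < j by rewrite ij /= !addnS !ltnS leq_addr.
have [ep lp _] := last_visit_split vi; have [eq lq _] := last_visit_split vj.
have wi := walks_last_exit i wF; have wj := walkF j.
rewrite perm1 ep is_walk_cat lp in wi; rewrite eq is_walk_cat lq in wj.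
have [/andP[wi1 _] /andP[_ wj2]] := (wi, wj).
(* Follow LE(F_i) to [v], then F_j to its end. Compared with LE(F_m), a walk from [a m] to [b m]
   where [i < m < j], this is in crossing position. *)
have wij : is_walk src tgt (a i) (b j)
    (head_upto tgt v (last_exit tgt (a i) (nth [::] F i)) ++
     tail_after tgt v (nth [::] F j)).
  by rewrite is_walk_cat lp wi1.
have wm := walks_last_exit m wF; rewrite perm1 in wm.
have /hasP[u um] := hcross (ltnSn i : i < m) lmj wij wm.
(* A common vertex on the part from LE(F_i) contradicts adjacency of [i] and [m]; one on F_j
   contradicts the induction hypothesis for [m] and [j], whose gap is smaller by one. *)
rewrite mem_verts_cat => /orP[ui|uj].
  have ui' : u \in erased_verts tgt a F i.
    by rewrite /erased_verts ep mem_verts_cat ui.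
  by have := avoid i m erefl u ui'; rewrite (sub_erased_verts um).
have jm : j = m + n.+1 :> nat by rewrite ij /= addSnnS.
have := IH m j jm u um.
by rewrite /verts eq mem_verts_cat uj orbT.
Qed.

Lemma fully_erased_adjacent F : fully_erased tgt a F -> adjacent_avoid F.
Proof.
move=> /forallP full; apply/adjacent_avoidP => i j ij u ui; apply/negP => uj.
have /allP/(_ u ui)/hitP[] := full i; exists j => //.
by rewrite ij.
Qed.

Lemma fully_erased_id s F : walks s F -> fully_erased tgt a F -> s = 1%g.
Proof. by move=> wF /fully_erased_adjacent; exact: adjacent_avoid_id. Qed.

Lemma LE_familyE F :
  LE_family src tgt a b F = [&& size F == k, walks 1%g F & fully_erased tgt a F].
Proof.
rewrite /LE_family -/(adjacent_avoid F); congr andb.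
have -> : [forall i, is_walk src tgt (a i) (b i) (nth [::] F i)] = walks 1%g F.
  by apply: eq_forallb => i; rewrite perm1.
have [wF|//] := boolP (walks 1%g F); apply/idP/idP; last exact: fully_erased_adjacent.
exact: adjacent_avoid_fully_erased.
Qed.

End Configurations.

(** * Products of generating series as counts of families *)

Section Families.
Variable E : choiceType.
Local Open Scope mset_scope.
Implicit Types (m : {mset E}) (p : seq E) (F : seq (seq E)).

Lemma perm_msetP p m : reflect (forall e, count_mem e p = m e) (perm_eq p m).
Proof.
apply: (iffP idP) => [/seq.permP pm e|pm]; first by rewrite pm count_mem_mset.
by apply/allP => e _ /=; rewrite pm count_mem_mset.
Qed.

Lemma mem_masks n (bs : seq bool) : (bs \in masks n) = (size bs == n).
Proof.
elim: n bs => [|n IH] [|c bs] //.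
  by apply/negbTE/negP => /allpairsPdep[? [? []]].
rewrite [RHS]eqSS -IH; apply/allpairsPdep/idP => [[c' [bs' [_ bs'n [_ ->]]]] //|bsn].
by exists c, bs; split=> //; case: c.
Qed.

Lemma mem_submonomials m m1 : (m1 \in submonomials m) = (m1 `<=` m).
Proof.
rewrite mem_undup; apply/mapP/msubsetP => [[bs _ ->] e|le_m1].
  by rewrite mset_seqE -count_mem_mset leq_count_mask.
have /count_subseqP[q /subseqP[bs sbs ->] pq] :
    forall e, count_mem e m1 <= count_mem e m by move=> e; rewrite !count_mem_mset.
exists bs; first by rewrite mem_masks sbs.
by rewrite -(seq_mset_id m1); apply/eq_seq_msetP.
Qed.

Lemma mem_splits n p F : (F \in splits n p) = (size F == n) && (flatten F == p).
Proof.
elim: n p F => [|n IH] p F.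
  by case: p => [|e p]; case: F => [|q F].
case: F => [|q F]; first by apply/negbTE/negP => /allpairsPdep[? [? []]].
apply/allpairsPdep/andP => [[l [G [_]]]|].
  by rewrite IH => /andP[/eqP sG /eqP eG] [-> ->] /=; rewrite sG eG cat_take_drop !eqxx.
move=> [sF /eqP <-]; exists (size q), F; rewrite -[flatten _]/(q ++ flatten F); split.
- by rewrite mem_iota size_cat ltnS leq_addr.
- by rewrite IH drop_size_cat // eqxx andbT.
- by rewrite take_size_cat.
Qed.

Lemma uniq_splits n p : uniq (splits n p).
Proof.
elim: n p => [|n IH] p; first by case: p.
apply: allpairs_uniq_dep => [||u w]; [exact: iota_uniq|by move=> l _; exact: IH|].
move=> /allpairsPdep[l [F [ll _ ->]]] /allpairsPdep[l' [F' [ll' _ ->]]] /= [e ->].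
move: ll ll'; rewrite !mem_iota !ltnS /= => ll ll'.
by have := congr1 size e; rewrite !size_takel // => ->.
Qed.

Lemma mem_families n m F :
  (F \in families n m) = (size F == n) && perm_eq (flatten F) m.
Proof.
apply/flattenP/andP => [[_ /mapP[p pm ->]]|[sF pF]].
  by rewrite mem_splits => /andP[-> /eqP ->]; rewrite -mem_permutations.
exists (splits n (flatten F)); last by rewrite mem_splits sF eqxx.
by apply: map_f; rewrite mem_permutations.
Qed.

Lemma uniq_families n m : uniq (families n m).
Proof.
have -> : families n m = [seq F | p <- permutations m, F <- splits n p].
  by congr flatten; apply: eq_map => p; rewrite map_id.
apply: (allpairs_uniq_dep (f := fun _ F => F)) => [|p _|u w].
- exact: permutations_uniq.
- exact: uniq_splits.
move=> /allpairsPdep[p [F [_ Fp ->]]] /allpairsPdep[p' [F' [_ Fp' ->]]] /= eF.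
move: Fp Fp'; rewrite -eF !mem_splits => /andP[_ /eqP <-] /andP[_ /eqP <-].
by [].
Qed.

Definition cons_pred (P : pred (seq E)) (Q : pred (seq (seq E))) : pred (seq (seq E)) :=
  fun F => if F is p :: F' then P p && Q F' else false.

Lemma count_cons_pred P Q (ps : seq (seq E)) (Fs : seq (seq (seq E))) :
  count (cons_pred P Q) [seq p :: F | p <- ps, F <- Fs] = count P ps * count Q Fs.
Proof.
elim: ps => //= p ps IH; rewrite count_cat IH mulnDl count_map; congr (_ + _).
case Pp: (P p); first by rewrite mul1n; apply: eq_count => F /=; rewrite Pp.
by rewrite mul0n -(count_pred0 Fs); apply: eq_count => F /=; rewrite Pp.
Qed.

(** Families are sorted by the monomial [m1] of their first walk. The pieces are disjoint because
    the first walk determines [m1], so no family is counted twice. *)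
Lemma families_cons n m :
  perm_eq (families n.+1 m)
    [seq x | m1 <- submonomials m,
             x <- [seq p :: F | p <- permutations m1, F <- families n (m `\` m1)]].
Proof.
apply: uniq_perm; first exact: uniq_families.
  apply: (allpairs_uniq_dep (f := fun _ x => x)) => [|m1 _|u w]; first exact: undup_uniq.
    apply: allpairs_uniq; [exact: permutations_uniq|exact: uniq_families|].
    by move=> [p F] [p' F'] _ _ /= [-> ->].
  move=> /allpairsPdep[m1 [x [_ xm1 ->]]] /allpairsPdep[m2 [x' [_ xm2 ->]]] /= ex.
  suff -> : m1 = m2 by rewrite ex.
  move: xm1 xm2; rewrite -ex => /allpairsP[[p F] [/= pm1 _ ->]].
  move=> /allpairsP[[p' F'] [/= pm2 _ [ep _]]]; move: pm1 pm2.
  rewrite -ep !mem_permutations => /perm_msetP pm1 /perm_msetP pm2.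
  by apply/msetP => e; rewrite -pm1 pm2.
move=> F; rewrite mem_families; apply/andP/allpairsPdep.
  case: F => [|p F] [//= /eqP[sF] /perm_msetP pm].
  have le_m e : (seq_mset p) e <= m e by rewrite mset_seqE -pm count_cat leq_addr.
  exists (seq_mset p), (p :: F); split=> //.
    by rewrite mem_submonomials; apply/msubsetP.
  apply: allpairs_f; first by rewrite mem_permutations perm_sym perm_eq_seq_mset.
  rewrite mem_families sF eqxx; apply/perm_msetP => e.
  by rewrite msetE2 mset_seqE -pm count_cat addKn.
move=> [m1 [_ [m1m /allpairsP[[p F'] [/= pm1 Fm1 ->]] ->]]].
move: m1m pm1 Fm1; rewrite mem_submonomials mem_permutations mem_families.
move=> /msubsetP m1m /perm_msetP pm1 /andP[/eqP sF /perm_msetP Fm].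
split; first by rewrite /= sF.
by apply/perm_msetP => e; rewrite /= count_cat pm1 Fm msetE2 subnKC.
Qed.

Lemma fps_mul_gf P n Q :
  fps_mul (gf_walks P) (gf_families n Q) = gf_families n.+1 (cons_pred P Q).
Proof.
apply: funext => m; rewrite /gf_families (seq.permP (families_cons n m)) /fps_mul.
rewrite count_flatten sumnE !big_map -[RHS]natz natr_sum.
apply: eq_bigr => m1 _; rewrite map_id count_cons_pred natrM !natz.
by [].
Qed.

Lemma fps_prod_gf (Ps : seq (pred (seq E))) :
  foldr (@fps_mul E) (@fps_one E) [seq gf_walks P | P <- Ps] =
  gf_families (size Ps) (all2 (fun P p => P p) Ps).
Proof.
elim: Ps => [|P Ps IH] /=.
  apply: funext => m; rewrite /fps_one /gf_families; congr Posz.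
  have [->|m0] := eqVneq m mset0; first by rewrite /families enum_mset0.
  apply/esym/eqP; rewrite -leqn0 leqNgt -has_count; apply/hasPn => F.
  rewrite mem_families => /andP[/nilP -> /perm_msetP pm]; case/eqP: m0.
  by apply/msetP => e; rewrite -pm mset0E.
by rewrite IH fps_mul_gf.
Qed.

End Families.

(** The map [g] permutes the selected entries and negates [f], so the sum equals its own opposite;
    an integer with this property is zero. *)
Lemma sum_sign_reversing (T : eqType) (X : seq T) (Q : pred T) (f : T -> int) (g : T -> T) :
    uniq X ->
    {in X, forall x, Q x -> [/\ g x \in X, Q (g x), g (g x) = x & f (g x) = - f x]%R} ->
  (\sum_(x <- X | Q x) f x = 0)%R.
Proof.
move=> uX gP; rewrite -big_filter; set Y := [seq x <- X | Q x]; set S := LHS.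
have gY : {in Y, forall x, [/\ g x \in Y, g (g x) = x & f (g x) = - f x]%R}.
  move=> x; rewrite mem_filter => /andP[Qx Xx].
  by have [gX Qg] := gP x Xx Qx; rewrite mem_filter Qg gX.
have permg : perm_eq (map g Y) Y.
  apply: uniq_perm; last 1 first.
  - move=> x; apply/mapP/idP => [[y yY ->]|xY]; first by case: (gY y yY).
    by have [gx gxx _] := gY x xY; exists (g x).
  - rewrite map_inj_in_uniq ?filter_uniq //; apply: (@can_in_inj _ _ _ _ g).
    by move=> x xY; case: (gY x xY).
  - exact: filter_uniq.
have SN : S = (- S)%R.
  rewrite /S -{1}(perm_big _ permg) big_map -sumrN big_seq [in RHS]big_seq.
  by apply: eq_bigr => x xY; case: (gY x xY).
have : (S *+ 2 = 0)%R by rewrite mulr2n {1}SN addNr.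
by move/eqP; rewrite mulrn_eq0 /= => /eqP.
Qed.

(** * The determinant identity for formal power series *)

Section Determinant.
Variables (V : eqType) (E : choiceType) (src tgt : E -> V).
Variables (k : nat) (a b : 'I_k -> V).
Hypothesis hcross : forall i i' j j' : 'I_k, i < i' -> j' < j ->
  forall p q : seq E,
    is_walk src tgt (a i) (b j) p -> is_walk src tgt (a i') (b j') q ->
    meet tgt (a i) p (a i') q.
Local Open Scope ring_scope.

Lemma all2_walks (s : 'S_k) (F : seq (seq E)) :
  all2 (fun (P : pred (seq E)) p => P p)
    [seq is_walk src tgt (a i) (b (s i)) | i <- enum 'I_k] F =
  (size F == k) && walks src tgt a b s F.
Proof.
set Ps := [seq _ | _ <- _].
have sP : size Ps = k by rewrite size_map size_enum_ord.
have nthP (l : 'I_k) : nth xpredT Ps l = is_walk src tgt (a l) (b (s l)).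
  by rewrite (nth_map l) ?size_enum_ord // nth_ord_enum.
rewrite all2E sP eq_sym; have [sF /=|//] := eqVneq (size F) k.
have sz : size (zip Ps F) = k by rewrite size_zip sP sF minnn.
apply/(all_nthP (xpredT, [::]))/forallP => [h l|h l].
  by have := h l; rewrite sz nth_zip ?sP ?sF //= nthP => /(_ (ltn_ord l)).
rewrite sz => lk; rewrite nth_zip ?sP ?sF //=.
by have := h (Ordinal lk); rewrite -nthP.
Qed.

Lemma fps_det_WAB (m : monomial E) :
  fps_det (WAB src tgt a b) m =
  \sum_(s : 'S_k) (-1) ^+ s * Posz (count (walks src tgt a b s) (families k m)).
Proof.
apply: eq_bigr => s _; congr (_ * _).
pose Ps := [seq is_walk src tgt (a i) (b (s i)) | i <- enum 'I_k].
rewrite (_ : [seq _ | i <- _] = [seq gf_walks P | P <- Ps]); last by rewrite -[RHS]map_comp.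
rewrite fps_prod_gf size_map size_enum_ord; congr Posz.
apply: eq_in_count => F; rewrite mem_families => /andP[sF _].
by rewrite all2_walks sF.
Qed.

Lemma Posz_count (T : Type) (P : pred T) (r : seq T) :
  Posz (count P r) = \sum_(x <- r | P x) 1.
Proof. by rewrite -sum1_count -natz natr_sum. Qed.

Lemma fps_det_LE : fps_det (WAB src tgt a b) = gf_families k (LE_family src tgt a b).
Proof.
apply: funext => m; rewrite fps_det_WAB /gf_families Posz_count.
set L := families k m.
have LP F : F \in L -> size F = k by rewrite mem_families => /andP[/eqP].
(* Split the families into good and tangled ones. Good families occur only for the identity, and
   give the right-hand side; the tangled ones cancel. *)
transitivity (\sum_(s : 'S_k) (\sum_(F <- L | walks src tgt a b s F && fully_erased tgt a F)
      (-1) ^+ s +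
    \sum_(F <- L | walks src tgt a b s F && ~~ fully_erased tgt a F) (-1) ^+ s) : int).
  apply: eq_bigr => s _; rewrite -bigID Posz_count big_distrr /=.
  by apply: eq_bigr => F _; rewrite mulr1.
rewrite big_split /= [X in _ + X](_ : _ = 0) ?addr0.
  rewrite (bigD1 1%g) //= [X in _ + X]big1 ?addr0 => [|s s1].
    rewrite big_seq_cond [RHS]big_seq_cond odd_perm1 expr0.
    apply: eq_bigl => F; rewrite LE_familyE //.
    by case FL: (F \in L) => //; rewrite LP ?eqxx.
  by apply: big1 => F /andP[wF eF]; case/eqP: s1; exact: (fully_erased_id hcross wF eF).
pose f (x : 'S_k * seq (seq E)) : int := (-1) ^+ x.1.
rewrite (eq_bigr (fun s : 'S_k => \sum_(F <- L)
    (if tangled src tgt a b (s, F) then f (s, F) else 0))) => [|s _]; last first.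
  rewrite -big_mkcond big_seq_cond [RHS]big_seq_cond.
  by apply: eq_bigl => F; case FL: (F \in L) => //; rewrite /tangled /= LP ?eqxx.
rewrite -(big_allpairs (F := fun x => if tangled src tgt a b x then f x else 0)) -big_mkcond /=.
apply: (@sum_sign_reversing _ _ _ _ (swap_config tgt a)).
  apply: allpairs_uniq; [exact: index_enum_uniq|exact: uniq_families|].
  by move=> [s F] [s' F'] _ _ /= [-> ->].
move=> x /allpairsP[[s F] [/= _ FL ->]] tx.
have [tx' xK sign flat] := swap_config_tangled tx; split=> //.
  (* The swap preserves the multiset of edges, so it stays within the finite list of families of
     monomial [m]. *)
  apply/allpairsP; exists (swap_config tgt a (s, F)); split; rewrite ?mem_index_enum //.
    move: FL; rewrite !mem_families => /andP[_ /(perm_trans flat) ->].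
    by case/and3P: tx' => ->.
  by case: (swap_config _ _ _).
by rewrite /f sign signrN.
Qed.
End Determinant.

(** * Nonnegative real weights *)

Section TotalNonnegativity.
Variables (V : eqType) (E : choiceType) (src tgt : E -> V).
Variables (R : realType) (wr : E -> R).
Hypothesis wr_ge0 : forall e, (0 <= wr e)%R.
Local Open Scope classical_set_scope.
Local Open Scope ereal_scope.

Local Notation wt p := (walk_wt_real wr p).

Lemma walk_wt_ge0 p : (0 <= wt p)%R.
Proof. by apply: prodr_ge0. Qed.

Lemma walk_wt_cat p q : wt (p ++ q) = (wt p * wt q)%R.
Proof. by rewrite /walk_wt_real big_cat. Qed.

Lemma esumZl (T : choiceType) (c : R) (S : set T) (f : T -> \bar R) :
    (0 <= c)%R -> (forall x, 0 <= f x) ->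
  esum S (fun x => c%:E * f x) = c%:E * esum S f.
Proof.
move=> c0 f0; rewrite /esum -ereal_supZl //; last first.
  by apply/set0P; exists (\sum_(x \in set0) f x); exists set0 => //; exact: fsets_set0.
congr ereal_sup; apply/seteqP; split=> y /=.
  by move=> [X SX <-]; exists (\sum_(x \in X) f x); [exists X|rewrite ge0_mule_fsumr].
by move=> [_ [X SX <-] <-]; exists X => //; rewrite ge0_mule_fsumr.
Qed.

Lemma subset_esum (T : choiceType) (S S' : set T) (f : T -> \bar R) :
  S `<=` S' -> esum S f <= esum S' f.
Proof.
move=> SS'; apply: ereal_sup_le => _ [X [finX XS] <-].
by exists X => //; split=> //; exact: subset_trans SS'.
Qed.

(** Distributivity for nonnegative sums, by merging iterated sums into one over pairs. Finiteness
    ensures that [fine] loses nothing. *)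
Lemma prod_esum_walks (Ps : seq (pred (seq E))) :
    (forall n, (n < size Ps)%N ->
      esum [set p | nth xpredT Ps n p] (fun p => (wt p)%:E) < +oo) ->
  (\prod_(P <- Ps) fine (esum [set p | P p] (fun p => (wt p)%:E)))%:E =
  esum [set F | all2 (fun (P : pred (seq E)) p => P p) Ps F] (fun F => (wt (flatten F))%:E).
Proof.
have wt0 p : 0 <= (wt p)%:E by rewrite lee_fin walk_wt_ge0.
elim: Ps => [|P Ps IH] fin.
  rewrite big_nil (_ : [set F | _] = [set [::]]); last first.
    by apply/seteqP; split=> [[]|_ ->].
  by rewrite esum_set1 // /walk_wt_real big_nil.
rewrite big_cons EFinM fineK; last first.
  by rewrite ge0_fin_numE; [exact: (fin 0%N)|exact: esum_ge0].
have {}IH := IH (fun n => fin n.+1); set G := (\prod_(P <- Ps) _)%R in IH *.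
have G0 : (0 <= G)%R by apply: prodr_ge0 => Q _; rewrite fine_ge0 // esum_ge0.
rewrite muleC -esumZl //.
pose tails := [set F | all2 (fun (P : pred (seq E)) p => P p) Ps F].
transitivity (esum [set p | P p] (fun p => esum tails (fun F => (wt p * wt (flatten F))%:E))).
  by apply: eq_esum => p _; rewrite muleC IH -esumZl ?walk_wt_ge0.
rewrite esum_esum; last by move=> p F _ _; rewrite lee_fin mulr_ge0 ?walk_wt_ge0.
rewrite [RHS](@reindex_esum _ _ _ ([set p | P p] `*`` fun=> tails) _ (fun x => x.1 :: x.2)).
  by apply: eq_esum => x _; rewrite /= walk_wt_cat.
split=> [[p F] [/= -> //]|[p F] [q G'] _ _ [-> ->] //|].
by case=> [//|p F] /andP[Pp PF]; exists (p, F).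
Qed.

Variables (k : nat) (a b : 'I_k -> V).
Hypothesis hcross : forall i i' j j' : 'I_k, (i < i')%N -> (j' < j)%N ->
  forall p q : seq E,
    is_walk src tgt (a i) (b j) p -> is_walk src tgt (a i') (b j') q ->
    meet tgt (a i) p (a i') q.
Hypothesis fin_walks : forall i j : 'I_k, walk_esum src tgt wr (a i) (b j) < +oo.

Definition walk_families (s : 'S_k) :=
  [set F | size F = k /\ walks src tgt a b s F].

Lemma prod_walk_value (s : 'S_k) :
  (\prod_i walk_value src tgt wr (a i) (b (s i)))%:E =
  esum (walk_families s) (fun F => (wt (flatten F))%:E).
Proof.
pose Ps := [seq is_walk src tgt (a i) (b (s i)) | i <- enum 'I_k].
have sP : size Ps = k by rewrite size_map size_enum_ord.
rewrite -[walk_families s](_ : [set F | all2 (fun (P : pred (seq E)) p => P p) Ps F] = _).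
  rewrite -prod_esum_walks; first by rewrite big_map big_enum.
  move=> n; rewrite sP => nk.
  rewrite (nth_map (Ordinal nk)) ?size_enum_ord //; exact: fin_walks.
apply/seteqP; split=> F /=; rewrite all2_walks.
  by move=> /andP[/eqP].
by move=> [-> ->]; rewrite eqxx.
Qed.

Lemma det_walk_value_ge0 :
  (0 <= \det (\matrix_(i, j) walk_value src tgt wr (a i) (b j)))%R.
Proof.
pose f s := (\prod_i walk_value src tgt wr (a i) (b (s i)))%R.
have -> : (\det (\matrix_(i, j) walk_value src tgt wr (a i) (b j)))%R =
    (\sum_(s : 'S_k | ~~ odd_perm s) f s - \sum_(s : 'S_k | odd_perm s) f s)%R.
  rewrite /determinant (bigID (fun s : 'S_k => odd_perm s)) /= addrC -sumrN.
  congr (_ + _)%R; apply: eq_bigr => s.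
    move=> /negbTE ->; rewrite expr0 mul1r.
    by apply: eq_bigr => i _; rewrite mxE.
  move=> ->; rewrite expr1 mulN1r; congr (- _)%R.
  by apply: eq_bigr => i _; rewrite mxE.
rewrite subr_ge0 -lee_fin.
(* The even and odd parts are each a finite value, written as one nonnegative sum over
   configurations, so they can be compared without subtracting infinite sums. *)
pose configs (c : bool) : set ('S_k * seq (seq E)) :=
  [set` [seq s <- index_enum 'S_k | odd_perm s == c]] `*`` walk_families.
have sumE c : (\sum_(s : 'S_k | odd_perm s == c) f s)%:E =
    esum (configs c) (fun x => (wt (flatten x.2))%:E).
  rewrite -(esum_esum (a := fun _ F => (wt (flatten F))%:E)); last first.
    by move=> *; rewrite lee_fin walk_wt_ge0.
  rewrite esum_fset //; last first.
    by move=> s _; apply: esum_ge0 => F _; rewrite lee_fin walk_wt_ge0.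
  rewrite -fsbig_seq ?filter_uniq ?index_enum_uniq // big_filter -sumEFin.
  by apply: eq_bigr => s _; exact: prod_walk_value.
(* A good family forces the identity permutation, which is even; hence the involution is available
   on every odd configuration. *)
have tangled_odd x : configs true x -> tangled src tgt a b x.
  move=> [/= odd_x [sx wx]]; rewrite /tangled sx eqxx wx /=.
  apply/negP => /(fully_erased_id hcross wx) x1.
  by move: odd_x; rewrite x1 mem_filter odd_perm1.
rewrite -(eq_bigl _ _ (fun s : 'S_k => eqb_id (odd_perm s))) sumE.
rewrite -(eq_bigl _ _ (fun s : 'S_k => eqbF_neg (odd_perm s))) sumE.
have swap_inj : set_inj (configs true) (swap_config tgt a).
  move=> x y; rewrite !inE => /tangled_odd/swap_config_tangled[_ xK _ _].
  by move=> /tangled_odd/swap_config_tangled[_ yK _ _] e; rewrite -xK e yK.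
have -> : esum (configs true) (fun x => (wt (flatten x.2))%:E) =
    esum (swap_config tgt a @` configs true) (fun x => (wt (flatten x.2))%:E).
  rewrite esum_image //; apply: eq_esum => x /tangled_odd/swap_config_tangled[_ _ _ flat].
  by rewrite /walk_wt_real (perm_big _ flat).
apply: subset_esum => _ [x cx <-].
have [/and3P[/eqP sz wx _] _ sign _] := swap_config_tangled (tangled_odd x cx).
split=> //=; rewrite mem_filter mem_index_enum sign.
by case: cx => /=; rewrite mem_filter => /andP[/eqP ->].
Qed.

End TotalNonnegativity.

Theorem theorem6p4
  (V : eqType) (E : choiceType) (src tgt : E -> V)
  (* standing assumption: countably many walks of each length *)
  (hcount : forall (x y : V) (n : nat),
      countable [set es : seq E | is_walk src tgt x y es /\ size es = n])
  (k : nat) (a b : 'I_k -> V)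
  (hcross : forall i i' j j' : 'I_k, (i < i')%N -> (j' < j)%N ->
      forall p q : seq E,
        is_walk src tgt (a i) (b j) p -> is_walk src tgt (a i') (b j') q ->
        meet tgt (a i) p (a i') q) :
  fps_det (WAB src tgt a b) = gf_families k (LE_family src tgt a b)
  /\
  (forall (R : realType) (wr : E -> R),
      (forall e, (0 <= wr e)%R) ->
      (forall i j : 'I_k, (walk_esum src tgt wr (a i) (b j) < +oo)%E) ->
      totally_nonneg (\matrix_(i, j) walk_value src tgt wr (a i) (b j))).
Proof.
split=> [|R wr wr_ge0 fin r I J incI incJ]; first exact: fps_det_LE.
(* A minor is the determinant for the subfamilies of sources and sinks chosen by [I] and [J]; these
   are strictly increasing, so the crossing hypothesis is inherited. *)
rewrite (_ : \matrix_(p, q) _ =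
    \matrix_(p, q) walk_value src tgt wr ((a \o I) p) ((b \o J) q))%R; last first.
  by apply/matrixP => p q; rewrite !mxE.
apply: det_walk_value_ge0 => [//|i i' j j' ii' jj'|i j]; last exact: fin.
by apply: hcross; [exact: incI|exact: incJ].
Qed.
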